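(* The following properties of an operator system $\mathcal S$ are equivalent: (1) $\mathcal S$ is $(\mathrm{el},\max)$-nuclear, i.e. $\mathcal S\otimes_{\mathrm{el}}\mathcal T=\mathcal S\otimes_{\max}\mathcal T$ for every operator system $\mathcal T$; (2) for any operator systems $\mathcal S_1$ and $\mathcal T$ with $\mathcal S\subseteq\mathcal S_1$, the natural inclusion $\mathcal S\otimes_{\max}\mathcal T\to\mathcal S_1\otimes_{\max}\mathcal T$ is a complete order isomorphism onto its range.
   Context: Operator system: a selfadjoint subspace of some $\mathcal B(H)$ containing the identity (equivalently, an abstract Choi–Effros operator system). Inclusions of operator systems are unital complete order isomorphisms onto their ranges. Equality of two operator system structures on $\mathcal S\otimes\mathcal T$ means that the identity map is a complete order isomorphism. Tensor products: $\max$: $u\in M_n(\mathcal S\otimes_{\max}\mathcal T)^+$ iff for every $r>0$, $u+r(1\otimes1)_n$ (where $(1\otimes 1)_n$ is the unit of $M_n(\mathcal S\otimes\mathcal T)$) has the form $A(P\otimes Q)A^*$ with $P\in M_k(\mathcal S)^+$, $Q\in M_m(\mathcal T)^+$, $A\in M_{n,km}$. $\mathrm{el}$: the structure on $\mathcal S\otimes\mathcal T$ from its inclusion in $I(\mathcal S)\otimes_{\max}\mathcal T$, where $I(\mathcal S)$ is the injective envelope of $\mathcal S$. *)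

(* Defs.v *)
From HB Require Import structures.
From mathcomp Require Import all_boot all_order all_algebra.
From mathcomp Require Import complex mxtens.
From mathcomp Require Import boolp classical_sets reals.
Set Implicit Arguments.
Unset Strict Implicit.
Unset Printing Implicit Defensive.

Import Order.TTheory GRing.Theory Num.Theory.
Local Open Scope ring_scope.
Local Open Scope classical_set_scope.
Local Open Scope quotient_scope.
Local Open Scope complex_scope.

(** * Algebraic tensor product of modules over a commutative ring

    A list [:: (x1, y1); ...; (xn, yn)] stands for the formal sum of the
    xi (x) yi; negatives need no separate letter since - (x (x) y) is
    represented by (- x, y). *)

Section Tensor.
Variables (K : comNzRingType) (U V : lmodType K).
Implicit Types (u v w : seq (U * V)).

Inductive tens_rel : seq (U * V) -> seq (U * V) -> Prop :=
| tens_refl u : tens_rel u u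
| tens_sym u v : tens_rel u v -> tens_rel v u
| tens_trans u v w : tens_rel u v -> tens_rel v w -> tens_rel u w
| tens_catC u v : tens_rel (u ++ v) (v ++ u)
| tens_cat2r u v w : tens_rel u v -> tens_rel (u ++ w) (v ++ w)
| tens_addl x x' y : tens_rel [:: (x + x', y)] [:: (x, y); (x', y)]
| tens_addr x y y' : tens_rel [:: (x, y + y')] [:: (x, y); (x, y')]
| tens_scale (a : K) x y : tens_rel [:: (a *: x, y)] [:: (x, a *: y)]
| tens_0l y : tens_rel [:: (0, y)] [::].

Definition tens_relb u v : bool := `[< tens_rel u v >].

Fact tens_relb_equiv : equiv_class_of tens_relb.
Proof.
split.
- by move=> u; apply/asboolP/tens_refl.
- by move=> u v; apply/asboolP/asboolP; exact: tens_sym.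
- move=> v u w /asboolP uv /asboolP vw; apply/asboolP.
  exact: tens_trans uv vw.
Qed.

Canonical tens_equiv := EquivRelPack tens_relb_equiv.

Definition tens : Type := {eq_quot tens_equiv}.
HB.instance Definition _ : EqQuotient _ tens_equiv tens := EqQuotient.on tens.
HB.instance Definition _ := Choice.on tens.

Lemma tensW (P : tens -> Prop) :
  (forall u, P (\pi_tens u)) -> forall p, P p.
Proof. by move=> Ppi p; rewrite -[p]reprK; exact: Ppi. Qed.

Lemma tens_eqP u v : \pi_tens u = \pi_tens v <-> tens_rel u v.
Proof.
split; first by move=> /eqmodP /asboolP.
by move=> h; apply/eqmodP/asboolP.
Qed.

Lemma tens_cat u u' v v' :
  tens_rel u u' -> tens_rel v v' -> tens_rel (u ++ v) (u' ++ v').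
Proof.
move=> uu' vv'; apply: tens_trans (tens_cat2r _ uu') _.
apply: tens_trans (tens_catC _ _) _.
by apply: tens_trans (tens_cat2r _ vv') _; exact: tens_catC.
Qed.

Definition seq_scale (a : K) u := [seq (a *: p.1, p.2) | p <- u].

Lemma tens_rel_scale a u v :
  tens_rel u v -> tens_rel (seq_scale a u) (seq_scale a v).
Proof.
elim=> {u v}.
- by move=> u; exact: tens_refl.
- by move=> u v _; exact: tens_sym.
- by move=> u v w _ uv _; exact: tens_trans.
- by move=> u v; rewrite /seq_scale !map_cat; exact: tens_catC.
- by move=> u v w _ uv; rewrite /seq_scale !map_cat; exact: tens_cat2r.
- by move=> x x' y /=; rewrite scalerDr; exact: tens_addl.
- by move=> x y y' /=; exact: tens_addr.
- by move=> b x y /=; rewrite scalerA mulrC -scalerA; exact: tens_scale.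
- by move=> y /=; rewrite scaler0; exact: tens_0l.
Qed.

Lemma tens_rel_scale0 u : tens_rel (seq_scale 0 u) [::].
Proof.
elim: u => [|[x y] u IHu] /=; first exact: tens_refl.
by rewrite scale0r; exact: (tens_cat (tens_0l y) IHu).
Qed.

Lemma tens_rel_scaleDl a b u :
  tens_rel (seq_scale (a + b) u) (seq_scale a u ++ seq_scale b u).
Proof.
elim: u => [|[x y] u IHu] /=; first exact: tens_refl.
rewrite scalerDl -cat1s.
apply: tens_trans (tens_cat (tens_addl _ _ _) IHu) _ => /=.
rewrite -cat1s -(cat1s _ (_ ++ (_ :: _))); apply: tens_cat (tens_refl _) _.
rewrite -cat1s -(cat1s _ (seq_scale b u)) !catA.
exact: tens_cat (tens_catC _ _) (tens_refl _).
Qed.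

Let tadd (p q : tens) : tens := \pi_tens (repr p ++ repr q).
Let tscale (a : K) (p : tens) : tens := \pi_tens (seq_scale a (repr p)).
Let tzero : tens := \pi_tens [::].
Let topp := tscale (- 1).

Lemma tens_repr_pi u : tens_rel (repr (\pi_tens u)) u.
Proof. by apply/tens_eqP; rewrite reprK. Qed.

Let tadd_pi u v : tadd (\pi_tens u) (\pi_tens v) = \pi_tens (u ++ v).
Proof. by apply/tens_eqP; apply: tens_cat; exact: tens_repr_pi. Qed.

Let tscale_pi a u : tscale a (\pi_tens u) = \pi_tens (seq_scale a u).
Proof. by apply/tens_eqP; apply: tens_rel_scale; exact: tens_repr_pi. Qed.

Let taddA : associative tadd.
Proof.
move=> p q r; elim/tensW: p => u; elim/tensW: q => v; elim/tensW: r => w.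
by rewrite !tadd_pi catA.
Qed.

Let taddC : commutative tadd.
Proof.
move=> p q; elim/tensW: p => u; elim/tensW: q => v; rewrite !tadd_pi.
by apply/tens_eqP; exact: tens_catC.
Qed.

Let tadd0 : left_id tzero tadd.
Proof. by move=> p; elim/tensW: p => u; rewrite tadd_pi. Qed.

Let tscale1 : left_id 1 tscale.
Proof.
move=> p; elim/tensW: p => u; rewrite tscale_pi /seq_scale -[in RHS](map_id u).
by congr (\pi_tens _); apply: eq_map => -[x y] /=; rewrite scale1r.
Qed.

Let tscaleDl p : {morph tscale^~ p : a b / a + b >-> tadd a b}.
Proof.
move=> a b; elim/tensW: p => u; rewrite !tscale_pi tadd_pi.
by apply/tens_eqP; exact: tens_rel_scaleDl.
Qed.

Let taddN : left_inverse tzero topp tadd.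
Proof.
move=> p; rewrite -{2}[p]tscale1 -tscaleDl addNr.
elim/tensW: p => u; rewrite tscale_pi.
by apply/tens_eqP; exact: tens_rel_scale0.
Qed.

HB.instance Definition _ :=
  GRing.isZmodule.Build tens taddA taddC tadd0 taddN.

Let tscaleA a b p : tscale a (tscale b p) = tscale (a * b) p.
Proof.
elim/tensW: p => u; rewrite !tscale_pi /seq_scale -map_comp.
by congr (\pi_tens _); apply: eq_map => -[x y] /=; rewrite scalerA.
Qed.

Let tscaleDr : right_distributive tscale +%R.
Proof.
move=> a p q; elim/tensW: p => u; elim/tensW: q => v.
rewrite [_ + _]tadd_pi !tscale_pi [RHS]tadd_pi.
by rewrite /seq_scale map_cat.
Qed.

HB.instance Definition _ :=
  GRing.Zmodule_isLmodule.Build K tens tscaleA tscale1 tscaleDr tscaleDl.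

Definition tensv (x : U) (y : V) : tens := \pi_tens [:: (x, y)].

Lemma tens_piD u v : \pi_tens (u ++ v) = \pi_tens u + \pi_tens v.
Proof. by rewrite -tadd_pi. Qed.

Lemma tens_piZ a u : \pi_tens (seq_scale a u) = a *: \pi_tens u.
Proof. by rewrite -tscale_pi. Qed.

Lemma tens_piE u : \pi_tens u = \sum_(p <- u) tensv p.1 p.2.
Proof.
elim: u => [|[x y] u IHu]; first by rewrite big_nil.
by rewrite big_cons -IHu -cat1s tens_piD.
Qed.

Lemma tensvDl x x' y : tensv (x + x') y = tensv x y + tensv x' y.
Proof. by rewrite -tens_piD; apply/tens_eqP; exact: tens_addl. Qed.

Lemma tensvDr x y y' : tensv x (y + y') = tensv x y + tensv x y'.
Proof. by rewrite -tens_piD; apply/tens_eqP; exact: tens_addr. Qed.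

Lemma tensvZl a x y : tensv (a *: x) y = a *: tensv x y.
Proof. by rewrite -tens_piZ. Qed.

Lemma tensvZr a x y : tensv x (a *: y) = a *: tensv x y.
Proof.
by rewrite -tensvZl; apply/tens_eqP; apply: tens_sym; exact: tens_scale.
Qed.

Lemma tens_ind (P : tens -> Prop) :
  P 0 -> (forall x y z, P z -> P (tensv x y + z)) -> forall z, P z.
Proof.
move=> P0 PD z; elim/tensW: z => u; rewrite tens_piE.
by elim: u => [|p u IHu]; rewrite ?big_nil// big_cons; exact: PD.
Qed.

End Tensor.

Section TensorLift.
Variables (K : comNzRingType) (U V W : lmodType K).
Variable f : U -> V -> W.
Hypothesis f_linl : forall y, linear (f^~ y).
Hypothesis f_linr : forall x, linear (f x).

Let fDl x x' y : f (x + x') y = f x y + f x' y.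
Proof. by have := f_linl y 1 x x'; rewrite /= !scale1r. Qed.
Let fDr x y y' : f x (y + y') = f x y + f x y'.
Proof. by have := f_linr x 1 y y'; rewrite /= !scale1r. Qed.
Let f0l y : f 0 y = 0.
Proof. by apply: (addIr (f 0 y)); rewrite -fDl !add0r. Qed.
Let f0r x : f x 0 = 0.
Proof. by apply: (addIr (f x 0)); rewrite -fDr !add0r. Qed.
Let fZl a x y : f (a *: x) y = a *: f x y.
Proof. by have := f_linl y a x 0; rewrite /= f0l !addr0. Qed.
Let fZr a x y : f x (a *: y) = a *: f x y.
Proof. by have := f_linr x a y 0; rewrite /= f0r !addr0. Qed.

Definition tens_lift (z : tens U V) : W := \sum_(p <- repr z) f p.1 p.2.

Lemma tens_lift_rel u v : tens_rel u v ->
  \sum_(p <- u) f p.1 p.2 = \sum_(p <- v) f p.1 p.2.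
Proof.
elim=> {u v} //.
- by move=> u v w _ -> _ ->.
- by move=> u v; rewrite !big_cat /= addrC.
- by move=> u v w _ uv; rewrite !big_cat /= uv.
- by move=> x x' y; rewrite !big_cons !big_nil /= fDl !addr0.
- by move=> x y y'; rewrite !big_cons !big_nil /= fDr !addr0.
- by move=> a x y; rewrite !big_cons !big_nil /= fZl fZr.
- by move=> y; rewrite big_cons big_nil /= f0l addr0.
Qed.

Lemma tens_lift_pi u :
  tens_lift (\pi_(tens U V) u) = \sum_(p <- u) f p.1 p.2.
Proof. by apply: tens_lift_rel; exact: tens_repr_pi. Qed.

Lemma tens_lift_linear : linear tens_lift.
Proof.
move=> a p q; elim/tensW: p => u; elim/tensW: q => v.
rewrite -tens_piZ -tens_piD !tens_lift_pi big_cat /=; congr (_ + _).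
rewrite big_map scaler_sumr; apply: eq_bigr => p _ /=; exact: fZl.
Qed.

Lemma tens_liftE x y : tens_lift (tensv x y) = f x y.
Proof. by rewrite tens_lift_pi big_cons big_nil addr0. Qed.

End TensorLift.

(* f (x) g *)
Section TensorMap.
Variables (K : comNzRingType) (U U' V V' : lmodType K).
Variables (f : {linear U -> U'}) (g : {linear V -> V'}).

Definition tens_map : tens U V -> tens U' V' :=
  tens_lift (fun x y => tensv (f x) (g y)).

Let tens_map_linl y : linear (fun x => tensv (f x) (g y)).
Proof. by move=> a x x'; rewrite linearP tensvDl tensvZl. Qed.

Let tens_map_linr x : linear (fun y => tensv (f x) (g y)).
Proof. by move=> a y y'; rewrite linearP tensvDr tensvZr. Qed.

HB.instance Definition _ :=
  GRing.isLinear.Build K (tens U V) (tens U' V') *:%R tens_map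
    (tens_lift_linear tens_map_linl tens_map_linr).

Lemma tens_mapE x y : tens_map (tensv x y) = tensv (f x) (g y).
Proof. exact: (tens_liftE tens_map_linl tens_map_linr). Qed.

End TensorMap.

(** * Operator systems *)

Section MatrixOrder.
Variable R : realType.

(* A *m u *m A^*, for a scalar matrix A and a matrix u over a vector space *)
Definition mxcompr (V : lmodType R[i]) m n (A : 'M[R[i]]_(n, m))
    (u : 'M[V]_m) : 'M[V]_n :=
  \matrix_(i, j) \sum_k \sum_l (A i k * (A j l)^*) *: u k l.

(* In [matrix_order] only the data: a unit and a set of positive elements of
   M_n(V) for every n. *)
Record matrix_order (V : lmodType R[i]) := MatrixOrder {
  mo_unit : V;
  mo_pos : forall n, set 'M[V]_n }.

(* Choi-Effros axioms; note that e%:M is the unit of M_n(V). *)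
Record operator_system := OperatorSystem {
  os_sort :> lmodType R[i];
  os_star : os_sort -> os_sort;
  os_order :> matrix_order os_sort;
  os_starK : involutive os_star;
  os_starP : forall (a : R[i]) x y,
    os_star (a *: x + y) = a^* *: os_star x + os_star y;
  os_pos_herm : forall n (u : 'M_n), mo_pos os_order u ->
    map_mx os_star u^T = u;
  os_posD : forall n (u v : 'M_n),
    mo_pos os_order u -> mo_pos os_order v -> mo_pos os_order (u + v);
  os_posZ : forall n (r : R) (u : 'M_n),
    0 <= r -> mo_pos os_order u -> mo_pos os_order (map_mx ( *:%R r%:C) u);
  os_pos_proper : forall n (u : 'M_n),
    mo_pos os_order u -> mo_pos os_order (- u) -> u = 0;
  os_pos_compr : forall m n (A : 'M[R[i]]_(n, m)) (u : 'M_m),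
    mo_pos os_order u -> mo_pos os_order (mxcompr A u);
  os_unit_star : os_star (mo_unit os_order) = mo_unit os_order;
  os_order_unit : forall n (u : 'M_n), map_mx os_star u^T = u ->
    exists2 r : R, 0 < r &
      mo_pos os_order ((r%:C *: mo_unit os_order)%:M + u);
  os_archimedean : forall n (u : 'M_n),
    (forall r : R, 0 < r ->
      mo_pos os_order ((r%:C *: mo_unit os_order)%:M + u)) ->
    mo_pos os_order u }.

Section Maps.
Variables (V W : lmodType R[i]).
Variables (sV : matrix_order V) (sW : matrix_order W).

Definition unital (f : V -> W) : Prop := f (mo_unit sV) = mo_unit sW.

Definition completely_positive (f : V -> W) : Prop :=
  forall n (u : 'M[V]_n), mo_pos sV u -> mo_pos sW (map_mx f u).

Definition ucp (f : V -> W) : Prop := unital f /\ completely_positive f.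

(* complete order isomorphism onto the range *)
Definition complete_order_embedding (f : V -> W) : Prop :=
  injective f /\
  forall n (u : 'M[V]_n), mo_pos sV u <-> mo_pos sW (map_mx f u).

Definition complete_order_iso (f : V -> W) : Prop :=
  bijective f /\ complete_order_embedding f.

End Maps.

(* f realizes the inclusion of the operator system S in the operator
   system S1 *)
Definition os_inclusion (S S1 : operator_system) (f : S -> S1) : Prop :=
  unital S S1 f /\ complete_order_embedding S S1 f.

(** * Injective envelope *)

Definition os_injective (I : operator_system) : Prop :=
  forall (E F : operator_system) (j : {linear E -> F}) (f : {linear E -> I}),
    os_inclusion j -> ucp E I f ->
  exists2 g : {linear F -> I}, ucp F I g & forall x, g (j x) = f x.

(* I is injective, contains S through iota, and no proper intermediate
   operator subsystem between S and I is injective; the intermediate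
   subsystem is given as the range of an inclusion k : J -> I. *)
Definition injective_envelope (S I : operator_system)
    (iota : {linear S -> I}) : Prop :=
  [/\ os_inclusion iota, os_injective I &
    forall (J : operator_system) (j : {linear S -> J}) (k : {linear J -> I}),
      os_inclusion j -> os_inclusion k -> (forall x, k (j x) = iota x) ->
      os_injective J -> forall y : I, exists x : J, k x = y].

(** * Tensor products *)

(* Kronecker product, an element of M_{km}(V (x) W) *)
Definition mxtensv (V W : lmodType R[i]) k m (P : 'M[V]_k) (Q : 'M[W]_m) :
    'M[tens V W]_(k * m) :=
  \matrix_(a, b)
    let: (i, i') := mxtens_unindex a in
    let: (j, j') := mxtens_unindex b in
    tensv (P i j) (Q i' j').

Definition tens_unit (S T : operator_system) : tens S T :=
  tensv (mo_unit S) (mo_unit T).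

Definition max_order (S T : operator_system) : matrix_order (tens S T) :=
  @MatrixOrder (tens S T) (tens_unit S T) (fun n u =>
    forall r : R, 0 < r ->
    exists k m (P : 'M[S]_k) (Q : 'M[T]_m) (A : 'M[R[i]]_(n, k * m)),
      [/\ mo_pos S P, mo_pos T Q &
          u + (r%:C *: tens_unit S T)%:M = mxcompr A (mxtensv P Q)]).

(* The structure that S (x) T inherits from I (x)_max T through iota (x) id;
   it is the el structure when iota : S -> I is the injective envelope. *)
Definition el_order (S I : operator_system) (iota : {linear S -> I})
    (T : operator_system) : matrix_order (tens S T) :=
  @MatrixOrder (tens S T) (tens_unit S T) (fun n u =>
    mo_pos (max_order I T) (map_mx (tens_map iota idfun) u)).

Definition el_max_nuclear (S I : operator_system) (iota : {linear S -> I}) :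
    Prop :=
  forall T : operator_system,
    complete_order_iso (el_order iota T) (max_order S T) idfun.

End MatrixOrder.

(* Main.v *)
Require Import Defs.
From HB Require Import structures.
From mathcomp Require Import all_boot all_order all_algebra.
From mathcomp Require Import complex reals.
From mathcomp Require Import mxtens boolp classical_sets.
Set Implicit Arguments.
Unset Strict Implicit.
Unset Printing Implicit Defensive.
Import Order.TTheory GRing.Theory Num.Theory.
Local Open Scope ring_scope.

(** The maximal tensor product is functorial for ucp maps. If [S] sits in [S1]
    through [j], injectivity of [I] extends [iota] to a ucp map [g : S1 -> I]
    with [g \o j = iota], so positivity in [S1 (x)_max T] is pushed to
    [I (x)_max T], that is, to the el structure on [S (x) T]; nuclearity brings
    it back to [S (x)_max T]. Injectivity of [j (x) id] is pure linear algebra,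
    from a linear left inverse of [j]. Conversely, (2) for the inclusion [iota]
    of [S] in [I] is exactly nuclearity. *)

Section LeftInverse.
Local Open Scope classical_set_scope.
Variables (K : fieldType) (U V : lmodType K) (j : {linear U -> V}).

(* No membership of 0 is required, so that the empty chain of Zorn's lemma
   is bounded by the empty set. *)
Let indep_subspace (A : set V) : Prop :=
  (forall (a : K) x y, A x -> A y -> A (a *: x + y)) /\
  (forall u, A (j u) -> j u = 0).

(** Zorn's lemma yields a maximal [A] meeting the range of [j] only in 0; a vector outside [j U + A]
    could be adjoined to [A], against maximality. *)
Lemma linear_range_complement : exists A : set V,
  [/\ A 0, forall (a : K) x y, A x -> A y -> A (a *: x + y),
      forall u, A (j u) -> j u = 0 &
      forall v, exists u w, A w /\ v = j u + w].
Proof.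
have [|A [[AP Aj] Amax]] := @Zorn_bigcup V indep_subspace.
  move=> F FP Ftot; split=> [a x y [X FX Xx] [Y FY Yy]|u [X FX]]; last first.
    exact: (FP _ FX).2.
  have [XY|YX] := Ftot _ _ FX FY.
    by exists Y => //; apply: (FP _ FY).1 => //; exact: XY.
  by exists X => //; apply: (FP _ FX).1 => //; exact: YX.
(* The span of [v] and [A]; the case [w = 0] is separate because [A] might still be empty. *)
pose B v : set V := [set x | exists a w, (A w \/ w = 0) /\ x = a *: v + w].
have AB v : A `<=` B v.
  by move=> x Ax; exists 0, x; split; [left|rewrite scale0r add0r].
have A0P a x y : A x \/ x = 0 -> A y \/ y = 0 ->
    A (a *: x + y) \/ a *: x + y = 0.
  move=> [Ax|->] [Ay|->]; rewrite ?scaler0 ?addr0 ?add0r; [| |by left|by right].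
    by left; exact: AP.
  have A0 : A 0 by rewrite -(addNr x) -scaleN1r; exact: AP.
  by left; rewrite -[_ *: x]addr0; exact: AP.
have BP v : forall a x y, B v x -> B v y -> B v (a *: x + y).
  move=> a x y [b [w [Aw ->]]] [c [w' [Aw' ->]]].
  exists (a * b + c), (a *: w + w'); split; first exact: A0P.
  by rewrite scalerDr scalerA scalerDl addrACA.
have BA v : (forall u, B v (j u) -> j u = 0) -> B v `<=` A.
  move=> Bj; apply: contrapT => nBA.
  exact: (Amax (B v) (conj (AB v) nBA) (conj (BP v) Bj)).
have A0j u : A (j u) \/ j u = 0 -> j u = 0 by case=> // /Aj.
have A0 : A 0.
  (* [B 0] is [A] with 0 adjoined, so maximality forces 0 into [A]. *)
  apply: (BA 0); last by exists 0, 0; split; [right|rewrite scale0r add0r].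
  by move=> u [a [w [Aw]]]; rewrite scaler0 add0r => e; apply: A0j; rewrite e.
exists A; split=> // v; apply: contrapT => nv.
(* Otherwise maximality puts [v] in [A], and [v = j 0 + v] is a decomposition. *)
have [u [[a [w [Aw jE]]] ju0]] : exists u, B v (j u) /\ j u <> 0.
  apply: contrapT => nB; apply: nv; exists 0, v.
  rewrite linear0 add0r; split=> //; apply: (BA v); last first.
    by exists 1, 0; split; [right|rewrite scale1r addr0].
  by move=> u Bu; apply: contrapT => ju0; apply: nB; exists u.
have a0 : a != 0.
  apply/eqP => a0; apply: ju0; apply: A0j.
  by rewrite jE a0 scale0r add0r.
(* Solve [j u = a *: v + w] for [v]. *)
apply: nv; exists (a^-1 *: u), (- a^-1 *: w); split.
  rewrite -[_ *: w]addr0; apply: AP => //.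
  by case: Aw => [|->].
by rewrite linearZ /= jE scalerDr scalerA mulVf// scale1r scaleNr addrK.
Qed.

(** Project onto the range along the complement [A], then undo [j]. Decompositions are unique, which
    gives both linearity and cancellation. *)
Lemma linear_inj_cancel : injective j ->
  exists g : {linear V -> U}, cancel j g.
Proof.
move=> jinj; have [A [A0 AP Aj Av]] := linear_range_complement.
have AB x y : A x -> A y -> A (x - y).
  by move=> Ax Ay; rewrite addrC -scaleN1r; exact: AP.
have [g gP] : {g : V -> U & forall v, A (v - j (g v))}.
  apply: (@choice _ _ (fun v u => A (v - j u))) => v.
  by have [u [w [Aw ->]]] := Av v; exists u; rewrite addrC addKr.
have gE v u : A (v - j u) -> g v = u.
  move=> Au; apply/jinj/eqP; rewrite -subr_eq0 -linearB; apply/eqP/Aj.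
  suff -> : j (g v - u) = (v - j u) - (v - j (g v)) by exact: AB.
  by rewrite linearB opprB [RHS]addrC addrA subrK.
have glin : linear g.
  move=> a x y; apply: gE; rewrite linearP opprD addrACA -scalerBr.
  exact: AP.
pose gL := GRing.isLinear.Build K V U *:%R g glin.
pose G : {linear V -> U} := HB.pack g gL.
by exists G => u; apply: gE; rewrite subrr.
Qed.

End LeftInverse.

Section TensorMapComp.
Variable K : comNzRingType.

Lemma tens_map_comp (U U' U'' V V' V'' : lmodType K)
    (f : {linear U -> U'}) (f' : {linear U' -> U''}) (h : {linear U -> U''})
    (g : {linear V -> V'}) (g' : {linear V' -> V''}) (k : {linear V -> V''}) :
  (forall x, f' (f x) = h x) -> (forall y, g' (g y) = k y) ->
  forall z, tens_map f' g' (tens_map f g z) = tens_map h k z.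
Proof.
move=> fE gE; elim/tens_ind => [|x y z IHz]; first by rewrite !linear0.
by rewrite !linearD /= IHz !tens_mapE fE gE.
Qed.

Lemma tens_map_id (U V : lmodType K) (z : tens U V) :
  tens_map idfun idfun z = z.
Proof.
elim/tens_ind: z => [|x y z IHz]; first by rewrite linear0.
by rewrite linearD /= IHz tens_mapE.
Qed.

End TensorMapComp.

(** A linear left inverse [g] of [f] makes [g (x) id] a left inverse of [f (x) id]. *)
Lemma tens_map_inj (K : fieldType) (U U' V : lmodType K)
    (f : {linear U -> U'}) :
  injective f -> injective (tens_map f (idfun : {linear V -> V})).
Proof.
move=> /linear_inj_cancel[g fK]; apply: (can_inj (g := tens_map g idfun)) => z.
by rewrite (tens_map_comp (h := idfun) (k := idfun)) ?tens_map_id.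
Qed.

Section MaxTensor.
Variable R : realType.

Lemma map_mxcompr (V W : lmodType R[i]) (f : {linear V -> W}) m n
    (A : 'M[R[i]]_(n, m)) (u : 'M[V]_m) :
  map_mx f (mxcompr A u) = mxcompr A (map_mx f u).
Proof.
apply/matrixP => a b; rewrite !mxE linear_sum; apply: eq_bigr => k _ /=.
by rewrite linear_sum; apply: eq_bigr => l _; rewrite /= linearZ mxE.
Qed.

Lemma map_mxtensv (V V' W W' : lmodType R[i]) (f : {linear V -> V'})
    (g : {linear W -> W'}) k m (P : 'M[V]_k) (Q : 'M[W]_m) :
  map_mx (tens_map f g) (mxtensv P Q) = mxtensv (map_mx f P) (map_mx g Q).
Proof.
apply/matrixP => a b; rewrite !mxE.
case: (mxtens_unindex a) => i i'; case: (mxtens_unindex b) => l l'.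
by rewrite tens_mapE !mxE.
Qed.

(** A factorization [A (P (x) Q) A^*] is mapped to [A (f P (x) g Q) A^*] with the same [A], and
    unitality preserves the perturbation by [r] times the unit. *)
Lemma tens_map_ucp (S S' T T' : operator_system R)
    (f : {linear S -> S'}) (g : {linear T -> T'}) :
  ucp S S' f -> ucp T T' g ->
  ucp (max_order S T) (max_order S' T') (tens_map f g).
Proof.
move=> [f1 fpos] [g1 gpos].
have fg1 : tens_map f g (tens_unit S T) = tens_unit S' T'.
  by rewrite tens_mapE f1 g1.
split=> // n u upos r r0.
have [k [m [P [Q [A [Ppos Qpos uE]]]]]] := upos r r0.
exists k, m, (map_mx f P), (map_mx g Q), A; split; [exact: fpos|exact: gpos|].
rewrite -map_mxtensv -map_mxcompr -uE map_mxD; congr (_ + _).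
by apply/matrixP => a b; rewrite !mxE raddfMn /= linearZ /= fg1.
Qed.

Lemma os_inclusion_ucp (S S1 : operator_system R) (j : S -> S1) :
  os_inclusion j -> ucp S S1 j.
Proof. by move=> [j1 [_ jpos]]; split=> // n u /jpos. Qed.

Lemma ucp_id (V : lmodType R[i]) (sV : matrix_order V) :
  ucp sV sV (idfun : {linear V -> V}).
Proof. by split=> // n u; rewrite map_mx_id. Qed.

End MaxTensor.

Theorem lemma6p1 (R : realType) (S I : operator_system R)
    (iota : {linear S -> I}) (envI : injective_envelope iota) :
  el_max_nuclear iota <->
  (forall (S1 T : operator_system R) (j : {linear S -> S1}),
     os_inclusion j ->
     complete_order_embedding (max_order S T) (max_order S1 T)
       (tens_map j idfun)).
Proof.
have [iota_incl injI _] := envI; split=> [nuc S1 T j j_incl|emb T]; last first.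
  split; first by exists idfun.
  split=> // n u; rewrite map_mx_id //.
  (* Positivity in [el_order iota T] is by definition positivity of the image under
     [iota (x) id]. *)
  exact: iff_sym ((emb I T iota iota_incl).2 n u).
have j_ucp := os_inclusion_ucp j_incl.
have [g g_ucp gE] := injI _ _ j iota j_incl (os_inclusion_ucp iota_incl).
split; first exact: tens_map_inj j_incl.2.1.
move=> n u; split; first exact: (tens_map_ucp j_ucp (ucp_id T)).2.
move=> /(tens_map_ucp g_ucp (ucp_id T)).2; rewrite -map_mx_comp => upos.
have [_ [_ /(_ n u)]] := nuc T; rewrite map_mx_id // => -[+ _]; apply.
(* Since [g \o j = iota], the pushed matrix is the image of [u] under [iota (x) id]. *)
congr (mo_pos _ _): upos; apply: eq_map_mx => z /=.
exact: tens_map_comp.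
Qed.
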